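(* Let $(\mathbf Q,\otimes,I)$ be a symmetric monoidal category with all small biproducts such that $\mathbf Q$ is a quantaloid. Then $(\mathbf Q,\otimes,I)$ is a symmetric monoidal quantaloid if and only if $(\mathbf Q,\otimes,I)$ is an infinitely distributive symmetric monoidal category.
   Context: A quantaloid is a category in which every homset is a complete lattice and composition preserves arbitrary suprema in each argument separately. A symmetric monoidal quantaloid is a symmetric monoidal category $(\mathbf Q,\otimes,I)$ for which $\mathbf Q$ is a quantaloid such that each map $\mathbf Q(X,W)\times\mathbf Q(Y,Z)\to\mathbf Q(X\otimes Y,W\otimes Z)$, $(f,g)\mapsto f\otimes g$, preserves suprema in both arguments separately. A category has small biproducts if it has a zero object and every set-indexed family $(X_\alpha)_{\alpha\in A}$ has a biproduct: an object $\bigoplus_{\alpha}X_\alpha$ with morphisms $p_\beta:\bigoplus_\alpha X_\alpha\to X_\beta$ and $i_\beta:X_\beta\to\bigoplus_\alpha X_\alpha$ such that it is a product with projections $p_\beta$, a coproduct with injections $i_\beta$, and $p_\beta\circ i_\alpha$ is the identity if $\alpha=\beta$ and the zero morphism otherwise. A symmetric monoidal category is infinitely distributive if it has all small coproducts and for each object $X$ and each set-indexed family $(Y_\alpha)_{\alpha\in A}$ of objects the canonical morphism $[\mathrm{id}_X\otimes i_{Y_\alpha}]_{\alpha\in A}:\coprod_{\alpha\in A}(X\otimes Y_\alpha)\to X\otimes\coprod_{\alpha\in A}Y_\alpha$ is an isomorphism. *)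

(* Defs.v *)
From Stdlib Require Import Relations Ensembles Image.

Set Implicit Arguments.
Unset Strict Implicit.
Unset Printing Implicit Defensive.

(* One fixed universe of "small sets": it hosts both the hom-sets (categories
   are locally small) and the index sets of small (co/bi)products, so that a
   subset of a hom-set can itself index a family. Objects may form a large
   type. *)
Definition SmallType := Type.

Declare Scope cat_scope.
Open Scope cat_scope.

Reserved Notation "g ∘ f" (at level 40, left associativity).
Reserved Notation "X ⊗ Y" (at level 36, left associativity).
Reserved Notation "f ⊠ g" (at level 36, left associativity).

Record Category := {
  Ob :> Type;
  Hom : Ob -> Ob -> SmallType;
  idm : forall X, Hom X X;
  comp : forall X Y Z, Hom Y Z -> Hom X Y -> Hom X Z
    where "g ∘ f" := (comp g f);
  comp_idl : forall X Y (f : Hom X Y), idm Y ∘ f = f;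
  comp_idr : forall X Y (f : Hom X Y), f ∘ idm X = f;
  comp_assoc : forall X Y Z W (h : Hom Z W) (g : Hom Y Z) (f : Hom X Y),
    h ∘ (g ∘ f) = (h ∘ g) ∘ f
}.

Arguments Hom {_} X Y.
Arguments idm {_} X.
Arguments comp {_ X Y Z} g f.
Notation "g ∘ f" := (comp g f) : cat_scope.

Section CategoryNotions.
Variable C : Category.

Definition is_iso (X Y : C) (f : Hom X Y) : Prop :=
  exists g : Hom Y X, g ∘ f = idm X /\ f ∘ g = idm Y.

Definition is_initial (Z : C) : Prop := forall X : C, exists! f : Hom Z X, True.
Definition is_terminal (Z : C) : Prop := forall X : C, exists! f : Hom X Z, True.
Definition is_zero_object (Z : C) : Prop := is_initial Z /\ is_terminal Z.

Definition is_zero_morphism (X Y : C) (f : Hom X Y) : Prop :=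
  exists (Z : C) (u : Hom X Z) (v : Hom Z Y), is_zero_object Z /\ f = v ∘ u.

Definition is_product (A : SmallType) (X : A -> C) (P : C)
    (p : forall a, Hom P (X a)) : Prop :=
  forall (Z : C) (f : forall a, Hom Z (X a)),
    exists! h : Hom Z P, forall a, p a ∘ h = f a.

(* [h] is the cotuple [f_a]_a with respect to the injections [i]. *)
Definition is_cotuple (A : SmallType) (X : A -> C) (S : C)
    (i : forall a, Hom (X a) S) (Z : C) (f : forall a, Hom (X a) Z)
    (h : Hom S Z) : Prop :=
  forall a, h ∘ i a = f a.

Definition is_coproduct (A : SmallType) (X : A -> C) (S : C)
    (i : forall a, Hom (X a) S) : Prop :=
  forall (Z : C) (f : forall a, Hom (X a) Z), exists! h : Hom S Z, is_cotuple i f h.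

Definition is_biproduct (A : SmallType) (X : A -> C) (B : C)
    (p : forall a, Hom B (X a)) (i : forall a, Hom (X a) B) : Prop :=
  is_product p /\ is_coproduct i /\
  (forall a, p a ∘ i a = idm (X a)) /\
  (forall a b, a <> b -> is_zero_morphism (p b ∘ i a)).

Definition has_small_coproducts : Prop :=
  forall (A : SmallType) (X : A -> C),
    exists (S : C) (i : forall a, Hom (X a) S), is_coproduct i.

Definition has_small_biproducts : Prop :=
  (exists Z : C, is_zero_object Z) /\
  (forall (A : SmallType) (X : A -> C),
    exists (B : C) (p : forall a, Hom B (X a)) (i : forall a, Hom (X a) B),
      is_biproduct p i).

End CategoryNotions.

Section Suprema.
Variables (T : Type) (le : relation T).

Definition is_supremum (S : Ensemble T) (s : T) : Prop :=
  (forall x, In T S x -> le x s) /\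
  (forall t, (forall x, In T S x -> le x t) -> le s t).

Definition is_infimum (S : Ensemble T) (s : T) : Prop :=
  (forall x, In T S x -> le s x) /\
  (forall t, (forall x, In T S x -> le t x) -> le t s).

Definition is_complete_lattice : Prop :=
  order T le /\
  (forall S, exists s, is_supremum S s) /\
  (forall S, exists s, is_infimum S s).

End Suprema.

Definition preserves_suprema (T U : Type) (leT : relation T) (leU : relation U)
    (f : T -> U) : Prop :=
  forall (S : Ensemble T) (s : T),
    is_supremum leT S s -> is_supremum leU (Im T U S f) (f s).

Record Quantaloid (C : Category) := {
  hom_le : forall X Y : C, relation (Hom X Y);
  hom_complete_lattice : forall X Y : C, is_complete_lattice (@hom_le X Y);
  comp_sup_l : forall (X Y Z : C) (f : Hom X Y),
    preserves_suprema (@hom_le Y Z) (@hom_le X Z) (fun g => g ∘ f);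
  comp_sup_r : forall (X Y Z : C) (g : Hom Y Z),
    preserves_suprema (@hom_le X Y) (@hom_le X Z) (fun f => g ∘ f)
}.

Arguments hom_le {C} q {X Y}.

Record SymmetricMonoidal (C : Category) := {
  tens_ob : C -> C -> C
    where "X ⊗ Y" := (tens_ob X Y);
  unit_ob : C;
  tens : forall X W Y Z : C, Hom X W -> Hom Y Z -> Hom (X ⊗ Y) (W ⊗ Z)
    where "f ⊠ g" := (tens f g);
  assoc : forall X Y Z : C, Hom ((X ⊗ Y) ⊗ Z) (X ⊗ (Y ⊗ Z));
  lunit : forall X : C, Hom (unit_ob ⊗ X) X;
  runit : forall X : C, Hom (X ⊗ unit_ob) X;
  braid : forall X Y : C, Hom (X ⊗ Y) (Y ⊗ X);

  tens_id : forall X Y : C, idm X ⊠ idm Y = idm (X ⊗ Y);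
  tens_comp : forall (X X' X'' Y Y' Y'' : C)
      (f' : Hom X' X'') (f : Hom X X') (g' : Hom Y' Y'') (g : Hom Y Y'),
    (f' ∘ f) ⊠ (g' ∘ g) = (f' ⊠ g') ∘ (f ⊠ g);

  assoc_iso : forall X Y Z, is_iso (assoc X Y Z);
  lunit_iso : forall X, is_iso (lunit X);
  runit_iso : forall X, is_iso (runit X);

  assoc_natural : forall (X X' Y Y' Z Z' : C)
      (f : Hom X X') (g : Hom Y Y') (h : Hom Z Z'),
    assoc X' Y' Z' ∘ ((f ⊠ g) ⊠ h) = (f ⊠ (g ⊠ h)) ∘ assoc X Y Z;
  lunit_natural : forall (X Y : C) (f : Hom X Y),
    lunit Y ∘ (idm unit_ob ⊠ f) = f ∘ lunit X;
  runit_natural : forall (X Y : C) (f : Hom X Y),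
    runit Y ∘ (f ⊠ idm unit_ob) = f ∘ runit X;
  braid_natural : forall (X X' Y Y' : C) (f : Hom X X') (g : Hom Y Y'),
    braid X' Y' ∘ (f ⊠ g) = (g ⊠ f) ∘ braid X Y;

  pentagon : forall W X Y Z : C,
    assoc W X (Y ⊗ Z) ∘ assoc (W ⊗ X) Y Z =
    (idm W ⊠ assoc X Y Z) ∘ assoc W (X ⊗ Y) Z ∘ (assoc W X Y ⊠ idm Z);
  triangle : forall X Y : C,
    (idm X ⊠ lunit Y) ∘ assoc X unit_ob Y = runit X ⊠ idm Y;
  hexagon : forall X Y Z : C,
    assoc Y Z X ∘ braid X (Y ⊗ Z) ∘ assoc X Y Z =
    (idm Y ⊠ braid X Z) ∘ assoc Y X Z ∘ (braid X Y ⊠ idm Z);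
  braid_involutive : forall X Y : C, braid Y X ∘ braid X Y = idm (X ⊗ Y)
}.

Arguments tens_ob {C} s X Y.
Arguments tens {C} s {X W Y Z} f g.

Definition is_symmetric_monoidal_quantaloid (C : Category)
    (M : SymmetricMonoidal C) (L : Quantaloid C) : Prop :=
  (forall (X W Y Z : C) (g : Hom Y Z),
    preserves_suprema (@hom_le C L X W)
      (@hom_le C L (tens_ob M X Y) (tens_ob M W Z)) (fun f => tens M f g)) /\
  (forall (X W Y Z : C) (f : Hom X W),
    preserves_suprema (@hom_le C L Y Z)
      (@hom_le C L (tens_ob M X Y) (tens_ob M W Z)) (fun g => tens M f g)).

(* The canonical morphism is required to be invertible for every choice of the
   coproducts of the families (Y_a) and (X ⊗ Y_a). *)
Definition is_infinitely_distributive (C : Category)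
    (M : SymmetricMonoidal C) : Prop :=
  has_small_coproducts C /\
  (forall (X : C) (A : SmallType) (Y : A -> C)
      (S : C) (i : forall a, Hom (Y a) S)
      (D : C) (j : forall a, Hom (tens_ob M X (Y a)) D)
      (c : Hom D (tens_ob M X S)),
    is_coproduct i -> is_coproduct j ->
    is_cotuple j (fun a => tens M (idm X) (i a)) c ->
    is_iso c).

(* Main.v *)
(** In a quantaloid with biproducts the zero morphisms are the bottom elements,
    and the identity of [⊕ Y_a] is the join of the idempotents [i_a ∘ p_a].

    If [⊗] preserves joins, [⋁ j_a ∘ (id ⊠ p_a)] inverts the canonical morphism
    [∐ (X ⊗ Y_a) -> X ⊗ ∐ Y_a].

    Conversely, distributivity over the empty family makes [X ⊗ -] preserve zero
    morphisms, and over general families it makes [X ⊗ ⊕ Y_a] a coproduct, so the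
    joins [id = ⋁ i_a ∘ p_a] are preserved by [X ⊗ -].  Every join of parallel
    morphisms is obtained from such a join by composition, as
    [⋁ g_a = [g_a] ∘ Δ] with [Δ] the diagonal. *)
Require Import Defs.
From Stdlib Require Import Relations Ensembles Image Classical.

Set Implicit Arguments.
Unset Strict Implicit.

Lemma is_supremum_ext (T : Type) (le : relation T) (S S' : Ensemble T) (s : T) :
  (forall x, In T S x <-> In T S' x) -> is_supremum le S s -> is_supremum le S' s.
Proof.
  intros E [U V]; split.
  - intros x Hx; apply U, E, Hx.
  - intros t Ht; apply V; intros x Hx; apply Ht, E, Hx.
Qed.

(** * Coproducts: uniqueness, transport along isomorphisms, projections *)

Section Coproducts.
Variable C : Category.

Lemma coproduct_hom_ext (A : SmallType) (X : A -> C) (S : C)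
    (i : forall a, Hom (X a) S) (Z : C) (h k : Hom S Z) :
  is_coproduct i -> (forall a, h ∘ i a = k ∘ i a) -> h = k.
Proof.
  intros Hi E; destruct (Hi Z (fun a => k ∘ i a)) as [m [_ U]].
  rewrite <- (U h E); apply U; intros a; reflexivity.
Qed.

Lemma coproduct_iso (A : SmallType) (X : A -> C) (S T : C)
    (i : forall a, Hom (X a) S) (j : forall a, Hom (X a) T) (c : Hom S T) :
  is_coproduct i -> is_cotuple i j c -> is_iso c -> is_coproduct j.
Proof.
  intros Hi Hc [d [dc cd]] Z f.
  destruct (Hi Z f) as [h [Hh U]].
  exists (h ∘ d); split.
  - intros a; rewrite <- (Hc a), comp_assoc, <- (comp_assoc h d c), dc, comp_idr.
    apply Hh.
  - intros k Hk.
    assert (E : h = k ∘ c).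
    { apply U; intros a; rewrite <- comp_assoc, (Hc a); apply Hk. }
    rewrite E, <- comp_assoc, cd; apply comp_idr.
Qed.

Lemma is_initial_empty_coproduct (S : C) (X : False -> C)
    (i : forall a, Hom (X a) S) :
  is_initial S <-> is_coproduct i.
Proof.
  split.
  - intros HS Z f; destruct (HS Z) as [h [_ U]]; exists h; split.
    + intros [].
    + intros k _; apply U; exact I.
  - intros Hi Z; destruct (Hi Z (fun a => match a with end)) as [h [_ U]].
    exists h; split; [exact I |].
    intros k _; apply U; intros [].
Qed.

(* The off-diagonal composites are inherited from a chosen biproduct, which
   avoids deciding equality of indices. *)
Lemma coproduct_projections (B : has_small_biproducts C)
    (A : SmallType) (X : A -> C) (S : C) (i : forall a, Hom (X a) S) :
  is_coproduct i ->
  exists p : forall a, Hom S (X a),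
    (forall a, p a ∘ i a = idm (X a)) /\
    (forall a b, a <> b -> is_zero_morphism (p b ∘ i a)).
Proof.
  intros Hi; destruct B as [_ B].
  destruct (B A X) as [P [q [k [_ [_ [Hid H0]]]]]].
  destruct (Hi P k) as [c [Hc _]].
  exists (fun b => q b ∘ c); split.
  - intros a; rewrite <- comp_assoc, (Hc a); apply Hid.
  - intros a b ab; rewrite <- comp_assoc, (Hc a); apply H0, ab.
Qed.

End Coproducts.

(** * Joins and bottom elements in the hom-lattices *)

Section Joins.
Variables (C : Category) (L : Quantaloid C).

Definition is_bottom (X Y : C) (h : Hom X Y) : Prop :=
  forall g : Hom X Y, hom_le L h g.

(** Joins are indexed by families rather than subsets, to match the indexing of biproducts. *)
Definition is_join (A : Type) (X Y : C) (f : A -> Hom X Y) (s : Hom X Y) : Prop :=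
  is_supremum (@hom_le C L X Y) (fun h => exists a, f a = h) s.

Lemma join_exists (A : Type) (X Y : C) (f : A -> Hom X Y) : exists s, is_join f s.
Proof. apply (hom_complete_lattice L X Y). Qed.

Lemma join_unique (A : Type) (X Y : C) (f : A -> Hom X Y) (s t : Hom X Y) :
  is_join f s -> is_join f t -> s = t.
Proof.
  intros [s1 s2] [t1 t2]; destruct (hom_complete_lattice L X Y) as [[_ _ anti] _].
  apply anti; auto.
Qed.

Lemma join_ext (A : Type) (X Y : C) (f g : A -> Hom X Y) (s : Hom X Y) :
  (forall a, f a = g a) -> is_join f s -> is_join g s.
Proof.
  intros E; apply is_supremum_ext; intros h; split; intros [a Ha]; exists a;
    rewrite <- Ha; auto.
Qed.

Lemma preserves_join (X Y X' Y' : C) (F : Hom X Y -> Hom X' Y')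
    (A : Type) (f : A -> Hom X Y) (s : Hom X Y) :
  preserves_suprema (@hom_le C L X Y) (@hom_le C L X' Y') F ->
  is_join f s -> is_join (fun a => F (f a)) (F s).
Proof.
  intros HF Hs; refine (is_supremum_ext _ (HF _ _ Hs)).
  intros h; split.
  - intros [x [a Ha] y Hy]; exists a; rewrite Ha; auto.
  - intros [a Ha]; apply Im_intro with (f a); [exists a; reflexivity | auto].
Qed.

(** A subset of a hom-set is a family indexed by its own elements, and this index type is small
    because hom-sets are. *)
Lemma join_preserving (X Y X' Y' : C) (F : Hom X Y -> Hom X' Y') :
  (forall (A : SmallType) (f : A -> Hom X Y) s,
     is_join f s -> is_join (fun a => F (f a)) (F s)) ->
  preserves_suprema (@hom_le C L X Y) (@hom_le C L X' Y') F.
Proof.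
  intros HF S s Hs.
  assert (J : is_join (fun a : {g | In _ S g} => proj1_sig a) s).
  { refine (is_supremum_ext _ Hs); intros h; split.
    - intros Hh; exists (exist _ h Hh); reflexivity.
    - intros [[g Hg] E]; simpl in E; rewrite <- E; exact Hg. }
  refine (is_supremum_ext _ (HF _ _ _ J)); intros h; split.
  - intros [[g Hg] E]; apply Im_intro with g; auto.
  - intros [g Hg y Hy]; exists (exist _ g Hg); auto.
Qed.

Lemma join_comp_l (A : Type) (X Y Z : C) (h : Hom Y Z) (f : A -> Hom X Y) s :
  is_join f s -> is_join (fun a => h ∘ f a) (h ∘ s).
Proof. apply (preserves_join (comp_sup_r (q := L) h)). Qed.

Lemma join_comp_r (A : Type) (X Y Z : C) (h : Hom X Y) (f : A -> Hom Y Z) s :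
  is_join f s -> is_join (fun a => f a ∘ h) (s ∘ h).
Proof. apply (preserves_join (F := fun g => g ∘ h) (comp_sup_l (q := L) h)). Qed.

Lemma join_comp_idm (A : Type) (X Y Z : C) (u : Hom Y Z) (v : Hom X Y)
    (e : A -> Hom Y Y) :
  is_join e (idm Y) -> is_join (fun a => u ∘ e a ∘ v) (u ∘ v).
Proof.
  intros He; apply (join_comp_l u), (join_comp_r v) in He.
  rewrite comp_idr in He; exact He.
Qed.

Lemma bottom_empty_join (X Y : C) (f : False -> Hom X Y) (h : Hom X Y) :
  is_bottom h <-> is_join f h.
Proof.
  split.
  - intros Hh; split; [intros x [[] _] | intros t _; apply Hh].
  - intros [_ H] g; apply H; intros x [[] _].
Qed.

Lemma preserves_bottom (X Y X' Y' : C) (F : Hom X Y -> Hom X' Y') (h : Hom X Y) :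
  preserves_suprema (@hom_le C L X Y) (@hom_le C L X' Y') F ->
  is_bottom h -> is_bottom (F h).
Proof.
  intros HF Hh; pose (f := fun a : False => match a return Hom X Y with end).
  apply (bottom_empty_join (fun a => F (f a))), preserves_join; [exact HF |].
  apply bottom_empty_join, Hh.
Qed.

Lemma bottom_comp_l (X Y Z : C) (g : Hom Y Z) (f : Hom X Y) :
  is_bottom f -> is_bottom (g ∘ f).
Proof. apply preserves_bottom, comp_sup_r. Qed.

Lemma bottom_through_initial (X Z Y : C) (u : Hom X Z) (v : Hom Z Y) :
  is_initial Z -> is_bottom (v ∘ u).
Proof.
  intros HZ.
  destruct (join_exists (fun a : False => match a return Hom Z Y with end))
    as [b Hb].
  apply bottom_empty_join in Hb.
  (* Initiality leaves a single morphism [Z -> Y], so [v] is the bottom, that is, the empty join. *)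
  assert (E : v = b) by (destruct (HZ Y) as [w [_ U]]; rewrite <- (U v), <- (U b); auto).
  rewrite E; apply (preserves_bottom (comp_sup_l (q := L) u) Hb).
Qed.

Lemma zero_morphism_bottom (X Y : C) (h : Hom X Y) :
  is_zero_morphism h -> is_bottom h.
Proof. intros [Z [u [v [[HZ _] E]]]]; rewrite E; apply bottom_through_initial, HZ. Qed.

Lemma join_single (A : Type) (X Y : C) (f : A -> Hom X Y) (b : A) :
  (forall a, a <> b -> is_bottom (f a)) -> is_join f (f b).
Proof.
  intros H; split.
  - intros x [a Ha]; rewrite <- Ha; destruct (classic (a = b)) as [E | E].
    + rewrite E; destruct (hom_complete_lattice L X Y) as [[refl _ _] _]; apply refl.
    + apply H, E.
  - intros t Ht; apply Ht; exists b; reflexivity.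
Qed.

(** After precomposition with [i b] every term except [e b ∘ i b = i b] is bottom, so the join
    agrees with the identity on each injection. The family [e] is left general to cover [i a ∘ p a],
    its tensor with an identity, and the terms of a composite with the canonical morphism. *)
Lemma coproduct_join_idm (A : SmallType) (X : A -> C) (S : C)
    (i : forall a, Hom (X a) S) (e : A -> Hom S S) :
  is_coproduct i ->
  (forall a, e a ∘ i a = i a) ->
  (forall a b, a <> b -> is_bottom (e b ∘ i a)) ->
  is_join e (idm S).
Proof.
  intros Hi Hid H0; destruct (join_exists e) as [s Hs].
  assert (E : s = idm S); [| rewrite <- E; exact Hs].
  apply (coproduct_hom_ext Hi); intros b; rewrite comp_idl.
  apply (join_unique (join_comp_r (i b) Hs)).
  enough (J : is_join (fun a => e a ∘ i b) (e b ∘ i b)) by (rewrite Hid in J; exact J).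
  apply (join_single (f := fun a => e a ∘ i b)).
  intros a ab; apply H0; congruence.
Qed.

End Joins.

(** * The tensor product and the two implications *)

Section Tensor.
Variables (C : Category) (M : SymmetricMonoidal C).

Lemma tens_comp_idm (X Y Y' Y'' : C) (g' : Hom Y' Y'') (g : Hom Y Y') :
  tens M (idm X) (g' ∘ g) = tens M (idm X) g' ∘ tens M (idm X) g.
Proof. rewrite <- tens_comp, comp_idl; reflexivity. Qed.

Lemma tens_split (X W Y Z : C) (f : Hom X W) (g : Hom Y Z) :
  tens M f g = tens M f (idm Z) ∘ tens M (idm X) g.
Proof. rewrite <- tens_comp, comp_idl, comp_idr; reflexivity. Qed.

Lemma tens_braid (X W Y Z : C) (f : Hom X W) (g : Hom Y Z) :
  tens M f g = braid M Z W ∘ tens M g f ∘ braid M X Y.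
Proof.
  rewrite braid_natural, <- comp_assoc, braid_involutive, comp_idr; reflexivity.
Qed.

Section Distributive.
Hypothesis D : is_infinitely_distributive M.

(** The canonical morphism is an isomorphism from a chosen coproduct, and it carries its injections
    to [id ⊠ i a]. *)
Lemma distributive_coproduct (X : C) (A : SmallType) (Y : A -> C) (S : C)
    (i : forall a, Hom (Y a) S) :
  is_coproduct i -> is_coproduct (fun a => tens M (idm X) (i a)).
Proof.
  intros Hi; destruct D as [coprod dist].
  destruct (coprod A (fun a => tens_ob M X (Y a))) as [T [j Hj]].
  destruct (Hj _ (fun a => tens M (idm X) (i a))) as [c [Hc _]].
  apply (coproduct_iso Hj Hc), (dist _ _ _ _ _ _ _ _ Hi Hj Hc).
Qed.

Lemma distributive_initial (X Z : C) : is_initial Z -> is_initial (tens_ob M X Z).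
Proof.
  intros HZ; pose (i := fun a : False => match a return Hom Z Z with end).
  apply (is_initial_empty_coproduct (fun a => tens M (idm X) (i a))).
  apply distributive_coproduct, is_initial_empty_coproduct, HZ.
Qed.

(** The tensored morphism factors through [X ⊗ N] with [N] a zero object, and this object is again
    initial. *)
Lemma distributive_tens_zero (L : Quantaloid C) (X Y Z : C) (h : Hom Y Z) :
  is_zero_morphism h -> is_bottom L (tens M (idm X) h).
Proof.
  intros [N [u [v [[HN _] E]]]]; rewrite E, tens_comp_idm.
  apply bottom_through_initial, distributive_initial, HN.
Qed.

Lemma distributive_tens_join (B : has_small_biproducts C) (L : Quantaloid C)
    (X Y Z : C) (A : SmallType) (g : A -> Hom Y Z) (s : Hom Y Z) :
  is_join L g s -> is_join L (fun a => tens M (idm X) (g a)) (tens M (idm X) s).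
Proof.
  intros Hs; destruct B as [_ B].
  (* The biproduct of [A] copies of [Y] carries both the diagonal [diag] and the cotuple [cog] of
     the family [g]. *)
  destruct (B A (fun _ => Y)) as [P [p [i [Hp [Hi [Hid H0]]]]]].
  destruct (Hp Y (fun _ => idm Y)) as [diag [Hdiag _]].
  destruct (Hi Z g) as [cog [Hcog _]].
  assert (Eg : forall a, cog ∘ (i a ∘ p a) ∘ diag = g a).
  { intros a; rewrite comp_assoc, (Hcog a), <- comp_assoc, (Hdiag a); apply comp_idr. }
  assert (Es : s = cog ∘ diag).
  { apply (join_unique Hs); apply (join_ext Eg).
    apply join_comp_idm.
    apply (coproduct_join_idm Hi).
    - intros a; rewrite <- comp_assoc, Hid; apply comp_idr.
    - intros a b ab; rewrite <- comp_assoc.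
      apply bottom_comp_l, zero_morphism_bottom, H0, ab. }
  rewrite Es, tens_comp_idm.
  apply join_ext with
    (fun a => tens M (idm X) cog ∘ tens M (idm X) (i a ∘ p a) ∘ tens M (idm X) diag).
  { intros a; rewrite <- !tens_comp_idm, Eg; reflexivity. }
  apply join_comp_idm.
  (* By distributivity [X ⊗ P] is a coproduct too, so the tensored idempotents again join to the
     identity. *)
  apply (coproduct_join_idm (distributive_coproduct (X := X) Hi)).
  - intros a; rewrite <- tens_comp_idm, <- comp_assoc, Hid, comp_idr; reflexivity.
  - intros a b ab; rewrite <- tens_comp_idm, <- comp_assoc, tens_comp_idm.
    apply bottom_comp_l, distributive_tens_zero, H0, ab.
Qed.

End Distributive.

Lemma distributive_quantaloid (B : has_small_biproducts C) (L : Quantaloid C) :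
  is_infinitely_distributive M -> is_symmetric_monoidal_quantaloid M L.
Proof.
  intros D.
  (* The factorization [f ⊠ g = (f ⊠ id) ∘ (id ⊠ g)] reduces a general [f] to an identity. *)
  assert (R : forall (X W Y Z : C) (f : Hom X W) (A : SmallType) (g : A -> Hom Y Z) s,
    is_join L g s -> is_join L (fun a => tens M f (g a)) (tens M f s)).
  { intros X W Y Z f A g s Hs; rewrite tens_split.
    apply join_ext with (fun a => tens M f (idm Z) ∘ tens M (idm X) (g a)).
    { intros a; symmetry; apply tens_split. }
    apply join_comp_l, distributive_tens_join; assumption. }
  split; intros X W Y Z h; apply join_preserving; intros A k s Hs.
  (* Conjugation by the braiding turns the left argument into the right one. *)
  - rewrite tens_braid.
    apply join_ext with (fun a => braid M Z W ∘ tens M h (k a) ∘ braid M X Y).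
    { intros a; symmetry; apply tens_braid. }
    apply join_comp_r, join_comp_l, R, Hs.
  - apply R, Hs.
Qed.

Lemma quantaloid_distributive (B : has_small_biproducts C) (L : Quantaloid C) :
  is_symmetric_monoidal_quantaloid M L -> is_infinitely_distributive M.
Proof.
  intros [_ HR]; split.
  { intros A X; destruct B as [_ B]; destruct (B A X) as [P [_ [i [_ [Hi _]]]]].
    exists P, i; exact Hi. }
  intros X A Y S i T j c Hi Hj Hc.
  (* [S] is an arbitrary coproduct, so its projections have to be constructed. *)
  destruct (coproduct_projections B Hi) as [p [Hid H0]].
  destruct (join_exists L (fun a => j a ∘ tens M (idm X) (p a))) as [d Hd].
  exists d; split.
  (* [d ∘ c] is the join of the [j a ∘ (id ⊠ p a) ∘ c], which act on the injections [j] as the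
     idempotents of a biproduct. *)
  - apply (join_unique (join_comp_r c Hd)), (coproduct_join_idm Hj).
    + intros a; rewrite <- comp_assoc, (Hc a), <- comp_assoc, <- tens_comp_idm, Hid.
      rewrite tens_id; apply comp_idr.
    + intros a b ab; rewrite <- comp_assoc, (Hc a), <- comp_assoc, <- tens_comp_idm.
      apply bottom_comp_l, (preserves_bottom (HR _ _ _ _ (idm X))).
      apply zero_morphism_bottom, H0, ab.
  (* [c ∘ d] is the join of the [id ⊠ (i a ∘ p a)], and [id ⊠ -] preserves the join [id] of the
     [i a ∘ p a]. *)
  - apply (join_unique (join_comp_l c Hd)); rewrite <- tens_id.
    apply join_ext with (fun a => tens M (idm X) (i a ∘ p a)).
    { intros a; rewrite comp_assoc, (Hc a); apply tens_comp_idm. }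
    apply (preserves_join (HR _ _ _ _ (idm X))), (coproduct_join_idm Hi).
    + intros a; rewrite <- comp_assoc, Hid; apply comp_idr.
    + intros a b ab; rewrite <- comp_assoc.
      apply bottom_comp_l, zero_morphism_bottom, H0, ab.
Qed.

End Tensor.

Theorem theorem3p6 (Q : Category) (M : SymmetricMonoidal Q)
    (B : has_small_biproducts Q) (L : Quantaloid Q) :
  is_symmetric_monoidal_quantaloid M L <-> is_infinitely_distributive M.
Proof.
  split; [apply quantaloid_distributive | apply distributive_quantaloid]; exact B.
Qed.
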